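(* Let $A$ be an affine semigroup and $p$ a prime number. Then there is a face $F$ of $C(A)$ such that $(p)\in\operatorname{Ass}_{\mathbb{Z}}\big((G(A)\cap\mathbb{R}F)/G(A\cap F)\big)$ if and only if ${}^{*p}A\ne{}^{+}A$. In particular, there are only finitely many primes $p$ for which ${}^{*p}A\neq{}^{+}A$.
   Context: $\mathbb{N}$ contains $0$. An affine semigroup is a finitely generated submonoid $A$ of $\mathbb{N}^n$. For an affine semigroup $B$, $G(B)\subset\mathbb{Z}^n$ is the subgroup generated by $B$; $C(A)$ is the cone of non-negative real combinations of elements of $A$; $\overline{A}=G(A)\cap C(A)$. Faces of $C(A)$ are faces in the usual sense of convex polyhedral cones (including $\{\mathbf 0\}$ and $C(A)$ itself), and $\mathbb{R}F$ is the real linear span of $F$. The seminormalization of $A$ is ${}^{+}A=\{\mathbf{v}\in G(A)\mid m\mathbf{v}\in A\text{ and }m'\mathbf{v}\in A\text{ for some coprime }m,m'\in\mathbb{N}\}$. For a prime $p$, the $p$-weak normalization of $A$ is ${}^{*p}A=\{\mathbf{v}\in\overline{A}\mid p^e\mathbf{v}\in A\text{ for some }e\in\mathbb{N}\}$. $\operatorname{Ass}_{\mathbb Z}(M)$ is the set of associated primes of the $\mathbb{Z}$-module $M$. *)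

(* Defs.v *)
From HB Require Import structures.
From mathcomp Require Import all_boot all_order all_algebra.
From mathcomp Require Import boolp classical_sets functions cardinality reals.

Set Implicit Arguments.
Unset Strict Implicit.
Unset Printing Implicit Defensive.

Import Order.TTheory GRing.Theory Num.Theory.
Local Open Scope classical_set_scope.
Local Open Scope ring_scope.

Definition monoid_gen (V : nmodType) (S : set V) : set V :=
  smallest [set M : set V | GRing.nmod_closed (fun v => v \in M)] S.

Definition group_gen (V : zmodType) (S : set V) : set V :=
  smallest [set H : set V | zmod_closed (fun v => v \in H)] S.

(* N^n is viewed inside Z^n as the vectors with non-negative entries. *)
Definition affine_semigroup (n : nat) (A : set 'rV[int]_n) : Prop :=
  (forall a, A a -> forall j, 0 <= a ord0 j) /\
  exists s : seq 'rV[int]_n, A = monoid_gen [set` s].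

Definition toR (R : realType) (n : nat) (v : 'rV[int]_n) : 'rV[R]_n :=
  map_mx intr v.
Arguments toR R {n} v.

Definition cone (R : realType) (n : nat) (A : set 'rV[int]_n) :
    set 'rV[R]_n :=
  [set x | exists (k : nat) (a : 'I_k -> 'rV[int]_n) (c : 'I_k -> R),
      (forall i, A (a i) /\ 0 <= c i) /\ x = \sum_i c i *: toR R (a i)].
Arguments cone R {n} A.

Definition linear_span (R : realType) (n : nat) (S : set 'rV[R]_n) :
    set 'rV[R]_n :=
  [set x | exists (k : nat) (a : 'I_k -> 'rV[R]_n) (c : 'I_k -> R),
      (forall i, S (a i)) /\ x = \sum_i c i *: a i].

Definition dotp (R : realType) (n : nat) (u x : 'rV[R]_n) : R :=
  (u *m x^T) ord0 ord0.

(* A face of a cone is its intersection with a supporting hyperplane through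
   the origin; u = 0 is allowed and gives the whole cone. *)
Definition face (R : realType) (n : nat) (C F : set 'rV[R]_n) : Prop :=
  exists u : 'rV[R]_n,
    (forall x, C x -> 0 <= dotp u x) /\ F = C `&` [set x | dotp u x = 0].

Definition normalization (R : realType) (n : nat) (A : set 'rV[int]_n) :
    set 'rV[int]_n :=
  group_gen A `&` toR R @^-1` cone R A.
Arguments normalization R {n} A.

Definition seminormalization (n : nat) (A : set 'rV[int]_n) :
    set 'rV[int]_n :=
  [set v | group_gen A v /\
     exists m m' : nat, [/\ coprime m m', A (v *+ m) & A (v *+ m')]].

Definition weak_normalization (R : realType) (p n : nat)
    (A : set 'rV[int]_n) : set 'rV[int]_n :=
  [set v | normalization R A v /\ exists e : nat, A (v *+ (p ^ e))].
Arguments weak_normalization R p {n} A.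

Definition principal_ideal (R : comNzRingType) (a : R) : set R :=
  [set b * a | b in setT].

Definition annihilator (R : comNzRingType) (M : lmodType R) (x : M) : set R :=
  [set a | a *: x = 0].

Definition is_prime_ideal (R : comNzRingType) (P : set R) : Prop :=
  idealr_closed (fun a => a \in P) /\ prime_idealr_closed (fun a => a \in P).

Definition Ass (R : comNzRingType) (M : lmodType R) : set (set R) :=
  [set P | is_prime_ideal P /\ exists x : M, P = annihilator x].

(* The quotient N / L of subgroups of V, constructed as N / (N :&: L). *)
Section SubgroupQuotient.
Variables (V : zmodType) (N L : zmodClosed V).

Definition subgroup : Type := {x : V | x \in N}.
HB.instance Definition _ := Choice.on subgroup.
HB.instance Definition _ := SubType.on subgroup.
HB.instance Definition _ :=
  [SubChoice_isSubZmodule of subgroup by <:].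

Definition in_subgroup : subgroup -> bool := fun x => val x \in L.

Lemma in_subgroup_zmod_closed : zmod_closed in_subgroup.
Proof.
split=> [|x y].
  by change (val (0 : subgroup) \in L); rewrite raddf0 rpred0.
move=> xL yL; change (val (x - y) \in L).
by rewrite raddfB; apply: rpredB.
Qed.

HB.instance Definition _ :=
  GRing.isZmodClosed.Build subgroup in_subgroup in_subgroup_zmod_closed.

Definition subgroup_quotient : zmodType :=
  Quotient.quot (GRing.ZmodClosed.clone subgroup in_subgroup _).

End SubgroupQuotient.

Section FaceQuotient.
Variables (R : realType) (n : nat) (A : set 'rV[int]_n) (F : set 'rV[R]_n).

Definition in_span_face : 'rV[int]_n -> bool :=
  fun v => v \in group_gen A `&` toR R @^-1` linear_span F.

Definition in_group_face : 'rV[int]_n -> bool :=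
  fun v => v \in group_gen (A `&` toR R @^-1` F).

Lemma group_gen_zmod_closed (V : zmodType) (S : set V) :
  zmod_closed (fun v => v \in group_gen S).
Proof.
split; first by apply/mem_set => H [[H0 _] _]; apply/set_mem.
move=> x y /set_mem xS /set_mem yS; apply/mem_set => H hH.
by case: (hH) => -[_ HB] _; apply/set_mem/HB; apply/mem_set;
  [apply: xS|apply: yS].
Qed.

Lemma linear_spanB (x y : 'rV[R]_n) :
  linear_span F x -> linear_span F y -> linear_span F (x - y).
Proof.
move=> [k [a [c [Fa ->]]]] [l [b [d [Fb ->]]]].
pose fab (i : 'I_k + 'I_l) := match i with inl i => a i | inr i => b i end.
pose fcd (i : 'I_k + 'I_l) := match i with inl i => c i | inr i => - d i end.
exists (k + l)%N, (fab \o @fintype.split k l), (fcd \o @fintype.split k l).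
split=> [i|]; first by rewrite /=; case: fintype.split.
rewrite big_split_ord /=; congr (_ + _).
  by apply: eq_bigr => i _; rewrite (unsplitK (inl i : 'I_k + 'I_l)).
rewrite -sumrN; apply: eq_bigr => i _.
by rewrite (unsplitK (inr i : 'I_k + 'I_l)) scaleNr.
Qed.

Lemma in_span_face_zmod_closed : zmod_closed in_span_face.
Proof.
have [G0 GB] := group_gen_zmod_closed A.
split=> [|x y]; rewrite !unfold_in /in_span_face.
  apply/mem_set; split; first exact/set_mem.
  exists 0%N, (fun=> 0), (fun=> 0); split=> [[] //|].
  by rewrite big_ord0 /toR map_mx0.
move=> /set_mem[xG xF] /set_mem[yG yF]; apply/mem_set; split.
  by apply/set_mem/GB; apply/mem_set.
by rewrite /preimage /= /toR map_mxB; apply: linear_spanB.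
Qed.

HB.instance Definition _ :=
  GRing.isZmodClosed.Build 'rV[int]_n in_span_face in_span_face_zmod_closed.

HB.instance Definition _ :=
  GRing.isZmodClosed.Build 'rV[int]_n in_group_face
    (group_gen_zmod_closed _).

(* (G(A) :&: RF) / G(A :&: F) *)
Definition face_quotient : zmodType :=
  subgroup_quotient
    (GRing.ZmodClosed.clone 'rV[int]_n in_span_face _)
    (GRing.ZmodClosed.clone 'rV[int]_n in_group_face _).

End FaceQuotient.

(* Main.v *)
Require Import Defs.
From HB Require Import structures.
From mathcomp Require Import all_boot all_order all_algebra.
From mathcomp Require Import boolp classical_sets functions cardinality reals.
From mathcomp Require Import lra.

(* If [v] lies in *pA but not in +A, put [w = p ^ e * v], which is in [A], and
   let [F] be the smallest face containing [w].  Were [v = a - b] with [a, b] in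
   [A :&: F], then [N * w - b] would be in [A] for some [N] because [w] is
   interior to [F], so [(N * p ^ e + 1) * v] would be in [A] and [v] in +A.
   Hence [v] has [p]-power order modulo [G(A :&: F)] and is not zero there.
   Conversely, if [p * x = a - b] with [a, b] in [A :&: F] and [x] is not in
   [G(A :&: F)], then [x + b] lies in *pA, and not in +A since Bezout would put
   it in [G(A :&: F)].
   For finiteness, [G(A :&: F)] is generated by some of the generators of [A],
   and the torsion primes of Z^n modulo such a subgroup divide a nonzero entry
   of a Smith normal form. *)

Set Implicit Arguments.
Unset Strict Implicit.
Unset Printing Implicit Defensive.

Import Order.TTheory GRing.Theory Num.Theory.
Local Open Scope classical_set_scope.
Local Open Scope ring_scope.

(** * Submonoids and subgroups generated by a set *)

Lemma addr_closedMn (V : nmodType) (M : set V) x k :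
  M 0 -> (forall a b, M a -> M b -> M (a + b)) -> M x -> M (x *+ k).
Proof. by move=> M0 MD Mx; elim: k => // k; rewrite mulrS; apply: MD. Qed.

Lemma monoid_gen_ind (V : nmodType) (S P : set V) :
  P 0 -> (forall x y, P x -> P y -> P (x + y)) -> S `<=` P ->
  monoid_gen S `<=` P.
Proof.
move=> P0 PD SP; apply: smallest_sub => //; split.
  exact: mem_set.
by move=> x y /set_mem Px /set_mem Py; apply/mem_set/PD.
Qed.

Lemma sub_monoid_gen (V : nmodType) (S : set V) : S `<=` monoid_gen S.
Proof. exact: sub_gen_smallest. Qed.

Lemma monoid_gen0 (V : nmodType) (S : set V) : monoid_gen S 0.
Proof. by move=> M [[/set_mem]]. Qed.

Lemma monoid_genD (V : nmodType) (S : set V) x y :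
  monoid_gen S x -> monoid_gen S y -> monoid_gen S (x + y).
Proof.
move=> Sx Sy M hM; case: (hM) => -[_ MD] _.
by apply/set_mem/MD; apply/mem_set; [apply: Sx | apply: Sy].
Qed.

Lemma monoid_genMn (V : nmodType) (S : set V) x k :
  monoid_gen S x -> monoid_gen S (x *+ k).
Proof.
by apply: addr_closedMn; [apply: monoid_gen0|apply: monoid_genD].
Qed.

Lemma group_gen_ind (V : zmodType) (S P : set V) :
  P 0 -> (forall x y, P x -> P y -> P (x - y)) -> S `<=` P ->
  group_gen S `<=` P.
Proof.
move=> P0 PB SP; apply: smallest_sub => //; split.
  exact: mem_set.
by move=> x y /set_mem Px /set_mem Py; apply/mem_set/PB.
Qed.

Lemma group_gen0 (V : zmodType) (S : set V) : group_gen S 0.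
Proof. by have [/set_mem] := group_gen_zmod_closed S. Qed.

Lemma group_genB (V : zmodType) (S : set V) x y :
  group_gen S x -> group_gen S y -> group_gen S (x - y).
Proof.
move=> Sx Sy; have [_ SB] := group_gen_zmod_closed S.
by apply/set_mem/SB; apply/mem_set.
Qed.

Lemma group_genD (V : zmodType) (S : set V) x y :
  group_gen S x -> group_gen S y -> group_gen S (x + y).
Proof.
move=> Sx Sy; rewrite -[y]opprK; apply: group_genB => //.
by rewrite -sub0r; apply: group_genB => //; apply: group_gen0.
Qed.

Lemma group_genMz (V : zmodType) (S : set V) x (k : int) :
  group_gen S x -> group_gen S (x *~ k).
Proof.
move=> Sx.
have h (j : nat) : group_gen S (x *+ j).
  by apply: (addr_closedMn (M := group_gen S)) => //;
    [apply: group_gen0|apply: group_genD].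
case: k => k; first exact: h.
rewrite NegzE mulrNz -[- _]add0r; apply: group_genB; first exact: group_gen0.
exact: h.
Qed.

Lemma sub_group_gen (V : zmodType) (S : set V) : S `<=` group_gen S.
Proof. exact: sub_gen_smallest. Qed.

Lemma group_gen_sub (V : zmodType) (S T : set V) :
  S `<=` group_gen T -> group_gen S `<=` group_gen T.
Proof.
move=> ST; apply: group_gen_ind => //; first exact: group_gen0.
exact: group_genB.
Qed.

Lemma group_gen_monoid (V : zmodType) (M : set V) x :
  M 0 -> (forall a b, M a -> M b -> M (a + b)) ->
  group_gen M x -> exists a b, [/\ M a, M b & x = a - b].
Proof.
move=> M0 MD; move: x.
pose P : set V := [set x | exists a b, [/\ M a, M b & x = a - b]].
rewrite -/(group_gen M `<=` P); apply: group_gen_ind.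
  by exists 0, 0; rewrite subr0.
- move=> _ _ [a [b [Ma Mb ->]]] [c [d [Mc Md ->]]].
  exists (a + d), (b + c); split; [exact: MD|exact: MD|].
  by rewrite opprB opprD addrACA.
by move=> a Ma; exists a, 0; rewrite subr0.
Qed.

(** Bezout: [x] is an integral combination of [x *~ a] and [x *~ b]. *)
Lemma zmod_closed_coprime (V : zmodType) (S : {pred V}) (x : V) (a b : int) :
  zmod_closed S -> coprimez a b -> x *~ a \in S -> x *~ b \in S -> x \in S.
Proof.
move=> clS /coprimezP[[u v] /= uv1] xa xb.
pose H : zmodClosed V := HB.pack S (GRing.isZmodClosed.Build V S clS).
rewrite -[x]mulr1z -uv1 mulrzDr [u * a]mulrC [v * b]mulrC !mulrzA.
by apply: (rpredD (S := H)); apply: (rpredMz (S := H)).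
Qed.

(** * Associated primes of a quotient of abelian groups *)

(** The annihilator of the class of [x] contains [p] and is proper when [x] is outside [L]; as [(p)]
    is maximal in the integers, it is then exactly [(p)]. *)
Lemma Ass_subgroup_quotient (V : zmodType) (N L : zmodClosed V) (p : nat) :
  prime p ->
  Ass (zmodule (subgroup_quotient N L)) (principal_ideal p%:Z) <->
  exists x, [/\ x \in N, x \notin L & x *+ p \in L].
Proof.
move=> p_pr.
have inP (a : int) : (a \in principal_ideal p%:Z) = (p%:Z %| a)%Z.
  apply/idP/idP.
    by move=> /set_mem[b _ <-]; apply: dvdz_mull.
  by move=> /dvdzP[b ->]; apply/mem_set; exists b.
have primeP : is_prime_ideal (principal_ideal p%:Z).
  split; first split.
  - by rewrite inP dvdz0.
  - by rewrite inP dvdzE /= dvdn1 neq_ltn prime_gt1 ?orbT.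
  - move=> a u v uP vP.
    change (is_true (a * u + v \in principal_ideal p%:Z)).
    move: uP vP; rewrite !inP => /dvdzP[k ->] /dvdzP[l ->].
    by apply/dvdzP; exists (a * k + l); rewrite mulrDl mulrA.
  move=> u v uvP.
  change (is_true
    ((u \in principal_ideal p%:Z) || (v \in principal_ideal p%:Z))).
  by rewrite !inP !dvdzE -Euclid_dvdM // -abszM -dvdzE -inP.
pose Q := subgroup_quotient N L.
pose I : zmodClosed (subgroup N) :=
  GRing.ZmodClosed.clone (subgroup N) (@in_subgroup V N L) _.
have piE (y : subgroup N) (a : int) :
    a *: (\pi_Q%qT y : zmodule Q) = 0 <-> val y *~ a \in L.
  rewrite scalezrE.
  have -> : (\pi_Q%qT y : zmodule Q) *~ a = \pi_Q%qT (y *~ a).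
    by rewrite raddfMz.
  have -> : val y *~ a = val (y *~ a) by rewrite raddfMz.
  have -> : (val (y *~ a) \in L) = (y *~ a - 0 \in I) by rewrite subr0.
  rewrite (Quotient.idealrBE I) (_ : \pi 0 = 0 :> Q)%qT; last exact: raddf0.
  by split=> [->|/eqP].
split.
  move=> [_ [x]].
  have [y ->] : exists y, x = \pi_Q%qT y by exists (repr x)%qT; rewrite reprK.
  move=> ann; exists (val y); split; first exact: valP.
    apply/negP => yL; have : 1 \in principal_ideal p%:Z.
      by rewrite ann; apply/mem_set/piE; rewrite mulr1z.
    by rewrite inP dvdzE /= dvdn1 gtn_eqF ?prime_gt1.
  rewrite pmulrn; apply/piE.
  have : p%:Z \in principal_ideal p%:Z by rewrite inP dvdzz.
  by rewrite ann => /set_mem.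
move=> [x [xN xL pxL]]; split=> //.
exists (\pi_Q%qT (exist _ x xN : subgroup N)).
apply/seteqP; split=> a.
  move=> /mem_set; rewrite inP => /dvdzP[b ->]; apply/piE => /=.
  by rewrite mulrC mulrzA -pmulrn rpredMz.
move=> /piE /= axL; apply/set_mem; rewrite inP.
apply: contraNT xL => pa.
apply: (@zmod_closed_coprime _ _ x a p%:Z _ _ axL); last by rewrite -pmulrn.
  by split=> [|u v uL vL]; [apply: rpred0|apply: rpredB].
by rewrite coprimez_sym coprimezE prime_coprime.
Qed.

(** * Linear functionals and the Farkas lemma *)

(* [dotp] over an arbitrary ring: supporting vectors are built over [rat], so
   that the Farkas coefficients have denominators to clear. *)
Definition dot (F : comNzRingType) (n : nat) (u x : 'rV[F]_n) : F :=
  (u *m x^T) ord0 ord0.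

Section DotTheory.
Variables (F : comNzRingType) (n : nat).
Implicit Types u x : 'rV[F]_n.

Lemma dotDl u u' x : dot (u + u') x = dot u x + dot u' x.
Proof. by rewrite /dot mulmxDl mxE. Qed.

Lemma dotDr u x x' : dot u (x + x') = dot u x + dot u x'.
Proof. by rewrite /dot linearD mulmxDr mxE. Qed.

Lemma dotZl c u x : dot (c *: u) x = c * dot u x.
Proof. by rewrite /dot -scalemxAl mxE. Qed.

Lemma dotZr c u x : dot u (c *: x) = c * dot u x.
Proof. by rewrite /dot linearZ -scalemxAr mxE. Qed.

Lemma dot0l x : dot 0 x = 0.
Proof. by rewrite -(scale0r 0) dotZl mul0r. Qed.

Lemma dot0r u : dot u 0 = 0.
Proof. by rewrite -(scale0r 0) dotZr mul0r. Qed.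

Lemma dotNr u x : dot u (- x) = - dot u x.
Proof. by rewrite -scaleN1r dotZr mulN1r. Qed.

Lemma dot_sumr u k (c : 'I_k -> F) (a : 'I_k -> 'rV[F]_n) :
  dot u (\sum_i c i *: a i) = \sum_i c i * dot u (a i).
Proof.
apply: (big_ind2 (fun x y => dot u x = y)); first exact: dot0r.
  by move=> x1 x2 y1 y2 <- <-; rewrite dotDr.
by move=> i _; rewrite dotZr.
Qed.

End DotTheory.

Lemma dot_map (F K : comNzRingType) (f : {rmorphism F -> K}) n
    (u x : 'rV[F]_n) :
  dot (map_mx f u) (map_mx f x) = f (dot u x).
Proof. by rewrite /dot map_trmx -map_mxM mxE. Qed.

(* Bartl's elimination: if [b] is really needed, some [u1] is nonnegative on [s]
   and negative on [g] and [b]; replacing each vector by its sum with a multiple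
   of [b] that is orthogonal to [u1] removes [b] from the list. *)
Lemma farkas (F : realFieldType) n (s : seq 'rV[F]_n) (g : 'rV[F]_n) :
  (forall u, (forall a, a \in s -> 0 <= dot u a) -> 0 <= dot u g) ->
  exists2 c : nat -> F, forall i, 0 <= c i &
    g = \sum_(i < size s) c i *: s`_i.
Proof.
(* Induction on the length rather than the list, since the hypothesis is applied both to [s] and to
   its image under [f]. *)
elim: {s}(size s) {-2}s (erefl (size s)) g => [|m IH] [|b s] //= sz g hg.
  exists (fun=> 0) => //; rewrite big_ord0.
  have g0 u : 0 <= dot u g by apply: hg => a; rewrite in_nil.
  apply/rowP => i; have := g0 (delta_mx 0 i); have := g0 (- delta_mx 0 i).
  have dotE : dot (delta_mx 0 i) g = g 0 i.
    by rewrite /dot -rowE !mxE.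
  rewrite -scaleN1r dotZl dotE !mxE; lra.
case: sz => sz.
have [hs|] := pselect (forall u, (forall a, a \in s -> 0 <= dot u a) ->
    0 <= dot u g).
  have [c c0 ->] := IH _ sz _ hs.
  exists (fun i => if i is j.+1 then c j else 0) => [[|i]//|].
  by rewrite big_ord_recl /= scale0r add0r.
move=> /existsNP[u0 /not_implyP[u0s /negP]]; rewrite -ltNge => u0g.
have u0b : dot u0 b < 0.
  rewrite ltNge; apply/negP => u0b.
  suff : 0 <= dot u0 g by rewrite leNgt u0g.
  by apply: hg => a; rewrite inE => /orP[/eqP->//|]; apply: u0s.
(* Scaled so that [dot u1 b = -1], which makes every [f a] below orthogonal to [u1]. *)
pose u1 := (- (dot u0 b)^-1) *: u0.
have k0 : 0 < - (dot u0 b)^-1 by rewrite oppr_gt0 invr_lt0.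
have u1b : dot u1 b = -1 by rewrite dotZl mulNr mulVf // lt_eqF.
have u1s a : a \in s -> 0 <= dot u1 a.
  by move=> /u0s ?; rewrite dotZl mulr_ge0 // ltW.
have u1g : dot u1 g < 0 by rewrite dotZl pmulr_rlt0.
clearbody u1.
pose f a := a + dot u1 a *: b.
have dotf u a : dot u (f a) = dot (u + dot u b *: u1) a.
  by rewrite /f dotDr dotZr dotDl dotZl [dot u1 a * _]mulrC.
have [|u hu|c c0 fg] := IH [seq f a | a <- s] _ (f g).
- by rewrite size_map.
(* The functional [u + dot u b *: u1] vanishes at [b], so [hg] only has to be checked on [s], where
   it agrees with [u] on the [f a]. *)
- rewrite dotf; apply: hg => a; rewrite inE => /orP[/eqP->|sa].
    by rewrite dotDl dotZl u1b mulrN1 subrr.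
  by rewrite -dotf; apply/hu/map_f.
(* Expanding [f] in [f g = \sum_j c j *: f s_j] and solving for [g] yields this coefficient of [b];
   it is nonnegative because [dot u1 g < 0]. *)
exists (fun i => if i is j.+1 then c j else
   \sum_(j < size s) c j * dot u1 s`_j - dot u1 g).
  case=> [|i] //; rewrite subr_ge0 (le_trans (ltW u1g)) // sumr_ge0 // => j _.
  by rewrite mulr_ge0 // u1s // mem_nth.
rewrite big_ord_recl /= scalerBl scaler_suml addrAC -big_split /=.
apply: (addIr (dot u1 g *: b)); rewrite subrK -/(f g) fg size_map.
by apply: eq_bigr => j _; rewrite (nth_map 0) // scalerDr scalerA addrC.
Qed.

(** * Integral vectors in a cone and minimal faces *)

Lemma toRD (R : realType) n (a b : 'rV[int]_n) :
  toR R (a + b) = toR R a + toR R b.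
Proof. exact: map_mxD. Qed.

Lemma toR0 (R : realType) n : toR R (0 : 'rV[int]_n) = 0.
Proof. exact: map_mx0. Qed.

Lemma toRMn (R : realType) n (a : 'rV[int]_n) k :
  toR R (a *+ k) = k%:R *: toR R a.
Proof. by rewrite /toR raddfMn -scaler_nat. Qed.

Notation toQ := (map_mx (intr : int -> rat)).

Lemma clear_denominators n (s : seq 'rV[int]_n) k (c : nat -> rat)
    (a : nat -> 'rV[int]_n) :
  (forall i, 0 <= c i) -> (forall i, (i < k)%N -> monoid_gen [set` s] (a i)) ->
  exists (m : nat) b, [/\ (0 < m)%N, monoid_gen [set` s] b &
     (\sum_(i < k) c i *: toQ (a i)) *+ m = toQ b].
Proof.
move=> c0; elim: k => [|k IH] sa.
  by exists 1%N, 0; split=> //; [apply: monoid_gen0|rewrite big_ord0 map_mx0].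
have [i ik|m [b [m0 Ab bE]]] := IH; first by apply: sa; rewrite ltnW.
pose d := `|denq (c k)|%N; pose q := `|numq (c k)|%N.
have ck : c k * d%:R = q%:R.
  rewrite !pmulrn absz_denq -numqE gez0_abs //.
  by rewrite numq_ge0.
have d0 : (0 < d)%N by rewrite absz_gt0 denq_neq0.
exists (m * d)%N, (b *+ d + a k *+ (q * m)); split.
- by rewrite muln_gt0 m0.
- by apply: monoid_genD; apply: monoid_genMn => //; apply: sa.
rewrite big_ord_recr /= mulrnDl mulrnA bE map_mxD !raddfMn; congr (_ + _).
rewrite scalerMnl [(m * d)%N]mulnC mulrnA.
by rewrite -[c k *+ d]mulr_natr ck -mulrnA scaler_nat.
Qed.

(** Farkas for [- toQ w] and the generators, with target [- toQ a]. A cone combination gives the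
    first case after clearing denominators. A separating functional gives the second: it is
    nonnegative at both [w] and [- w], hence zero at [w]. *)
Lemma face_dichotomy n (s : seq 'rV[int]_n) w a :
  monoid_gen [set` s] w -> monoid_gen [set` s] a ->
  (exists N, monoid_gen [set` s] (w *+ N - a)) \/
  exists u : 'rV[rat]_n, [/\ forall b, b \in s -> 0 <= dot u (toQ b),
    dot u (toQ w) = 0 & 0 < dot u (toQ a)].
Proof.
move=> Aw Aa; pose t := - toQ w :: [seq toQ b | b <- s].
have [h|] := pselect (forall u, (forall b, b \in t -> 0 <= dot u b) ->
    0 <= dot u (- toQ a)); last first.
  move=> /existsNP[u /not_implyP[ut /negP]].
  rewrite dotNr oppr_ge0 -ltNge => ua.
  have us b : b \in s -> 0 <= dot u (toQ b).
    by move=> sb; apply: ut; rewrite inE map_f ?orbT.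
  right; exists u; split=> //; apply/eqP; rewrite eq_le.
  have := ut (- toQ w); rewrite inE eqxx dotNr oppr_ge0 => -> //=.
  apply: (monoid_gen_ind (P := [set v | 0 <= dot u (toQ v)])) Aw => //=.
    by rewrite map_mx0 dot0r.
  by move=> x y ux uy; rewrite map_mxD dotDr addr_ge0.
left; have [c c0] := farkas h.
rewrite /t /= size_map big_ord_recl /= scalerN => aE.
(* Rounding up the coefficient of [w]: [w *+ N - a] is the combination with coefficients [N - c 0]
   at [w] and [c] at the generators, all nonnegative. *)
pose N := Num.bound (c 0).
pose e i := if i is j.+1 then c j.+1 else N%:R - c 0.
have e0 i : 0 <= e i.
  case: i => [|i]; last exact: c0.
  by rewrite /e subr_ge0; apply/ltW/archi_boundP.
have [|m [b [m0 Ab bE]]] := @clear_denominators _ s (size s).+1 e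
    (fun i => (w :: s)`_i) e0.
  case=> [|i] //= si; apply: sub_monoid_gen; exact: mem_nth.
have {}aE : toQ (w *+ (N * m) - a *+ m) = toQ b.
  rewrite -bE big_ord_recl /= mulrnA -mulrnBl raddfMn /= map_mxB raddfMn /=.
  congr (_ *+ _); rewrite aE scalerBl scaler_nat addrA.
  congr (_ + _); apply: eq_bigr => i _.
  by rewrite (nth_map 0) ?add0n.
exists (N * m)%N.
(* Clearing denominators also multiplied [a] by [m]; adding back [m - 1] copies of [a] stays in the
   semigroup. *)
have -> : w *+ (N * m) - a = b + a *+ m.-1.
  have <- : w *+ (N * m) - a *+ m = b.
    by move/matrixP: aE => aE; apply/matrixP => i j; have := aE i j;
       rewrite ![toQ _ _ _]mxE => /intr_inj.
  by case: m m0 {bE aE} => // m _; rewrite mulrS opprD addrA subrK.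
by apply: monoid_genD => //; apply: monoid_genMn.
Qed.

(* [u] cuts out the smallest face containing [w]. *)
Lemma minimal_face n (s : seq 'rV[int]_n) w :
  monoid_gen [set` s] w ->
  exists u : 'rV[rat]_n, [/\ forall a, monoid_gen [set` s] a ->
    0 <= dot u (toQ a), dot u (toQ w) = 0 &
    forall a, monoid_gen [set` s] a -> dot u (toQ a) = 0 ->
      exists N, monoid_gen [set` s] (w *+ N - a)].
Proof.
move=> Aw; pose D a := exists N, monoid_gen [set` s] (w *+ N - a).
(* Each generator failing [D] contributes a functional from [face_dichotomy] that is positive on it.
   All of them are nonnegative on [s] and vanish at [w], so their sum does too, and it vanishes at
   no failing generator. *)
have [u [us uw uD]] : exists u : 'rV[rat]_n,
    [/\ forall b, b \in s -> 0 <= dot u (toQ b), dot u (toQ w) = 0 &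
     forall a, a \in s -> dot u (toQ a) = 0 -> D a].
  have : {subset s <= s} by [].
  elim: {1 4}s => [|a t IH] ts.
    by exists 0; split=> [b _||//]; rewrite dot0l.
  have [b tb|u [us uw uD]] := IH; first by apply: ts; rewrite inE tb orbT.
  have sa : a \in s by apply: ts; rewrite inE eqxx.
  have Aa : monoid_gen [set` s] a by apply: sub_monoid_gen.
  have [Da|[u' [us' uw' ua']]] := face_dichotomy Aw Aa.
    by exists u; split=> // b; rewrite inE => /orP[/eqP->//|/uD].
  exists (u + u'); split=> [b sb||b].
  - by rewrite dotDl addr_ge0 ?us ?us'.
  - by rewrite dotDl uw uw' addr0.
  rewrite inE dotDl => /orP[/eqP->|tb].
    by have := us _ sa; move: ua'; lra.
  have sb : b \in s by apply: ts; rewrite inE tb orbT.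
  by have := us' _ sb; have := us _ sb => *; apply: uD => //; lra.
have h : monoid_gen [set` s] `<=`
    [set a | 0 <= dot u (toQ a) /\ (dot u (toQ a) = 0 -> D a)].
  apply: monoid_gen_ind => [|x y [ux Dx] [uy Dy]|a sa /=].
  - split; rewrite map_mx0 dot0r // => _; exists 0%N; rewrite subr0.
    exact: monoid_gen0.
  - split; rewrite map_mxD dotDr; first exact: addr_ge0.
    move=> xy0; have [|N1 h1] := Dx; first lra.
    have [|N2 h2] := Dy; first lra.
    exists (N1 + N2)%N; rewrite mulrnDr opprD addrACA; exact: monoid_genD.
  - by split; [apply: us|apply: uD].
by exists u; split=> // a /h[].
Qed.

(** * Torsion modulo finitely generated subgroups; numerical semigroups *)

Lemma group_gen_torsion_bound n (t : seq 'rV[int]_n) :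
  exists N, forall p x, prime p -> group_gen [set` t] (x *+ p) ->
    ~ group_gen [set` t] x -> (p <= N)%N.
Proof.
pose M := \matrix_(i < size t) t`_i.
have GE x : group_gen [set` t] x <-> exists y, x = y *m M.
  split.
    move: x; rewrite -/(group_gen [set` t] `<=` [set x | exists y, x = y *m M]).
    apply: group_gen_ind; first by exists 0; rewrite mul0mx.
      by move=> _ _ [y ->] [z ->]; exists (y - z); rewrite mulmxBl.
    move=> a /= ta; have it : (index a t < size t)%N by rewrite index_mem.
    exists (delta_mx 0 (Ordinal it)); rewrite -rowE rowK /= nth_index //.
  move=> [y ->]; rewrite mulmx_sum_row.
  apply: (big_ind (group_gen [set` t])); first exact: group_gen0.
    by move=> a b; apply: group_genD.
  move=> i _; rewrite -[y 0 i]intz scaler_int rowK; apply: group_genMz.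
  by apply: sub_group_gen => /=; apply: mem_nth.
have [L uL [U uU [d _ ME]]] := int_Smith_normal_form M.
set D := (X in L *m X *m U) in ME.
exists (\max_(i < size d) `|(d`_i)%R|)%N => p x p_pr /GE[y xpE] nGx.
rewrite leqNgt; apply/negP => pN; apply: nGx; apply/GE.
pose y' := y *m L; pose x' := x *m invmx U.
have x'E : x' *+ p = y' *m D.
  by rewrite /x' -scaler_nat scalemxAl scaler_nat xpE ME !mulmxA mulmxK.
(* Dividing [y'] by [p] solves [z *m D = x']. Where the diagonal vanishes, also past the end of [d]
   by the default 0, [y'] need not be divisible by [p], but [D] kills that coordinate, so 0 will
   do. *)
clearbody y'; pose z := \row_i (if d`_i == 0 then 0 else (y' ord0 i %/ p)%Z).
have zE : z *m D = x'.
  apply/rowP => j; apply: (@mulIf _ p%:R).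
    by rewrite pnatr_eq0 -lt0n prime_gt0.
  have x'j : x' ord0 j * p%:R = \sum_i y' ord0 i * D i j.
    by rewrite mulr_natr -mulmxnE x'E mxE.
  rewrite x'j mxE mulr_suml; apply: eq_bigr => i _.
  rewrite !mxE; have [ij|_] := eqVneq (i : nat) j; last by rewrite !mulr0 mul0r.
  have [->|di] := eqVneq d`_i 0; first by rewrite !mulr0 mul0r.
  rewrite mulr1n natz mulrAC divzK //.
  (* Only the diagonal entry contributes to column [j]. Since [p] exceeds every diagonal entry in
     absolute value, it cannot divide a nonzero [d_i], hence divides [y'_i]. *)
  have : (p%:Z %| y' ord0 i * d`_i)%Z.
    apply/dvdzP; exists (x' ord0 j); rewrite -[p%:Z]natz.
    rewrite x'j (bigD1 i) //= big1 ?addr0 => [|k ki].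
      by rewrite mxE ij eqxx.
    rewrite mxE; case: eqP => [kj|]; last by rewrite mulr0.
    by case/eqP: ki; apply: val_inj; rewrite /= kj ij.
  rewrite !dvdzE abszM Euclid_dvdM // => /orP[//|pd].
  have id : (i < size d)%N.
    by rewrite ltnNge; apply/negP => /(nth_default 0) d0; rewrite d0 in di.
  have := dvdn_leq _ pd; rewrite absz_gt0 => /(_ di).
  rewrite leqNgt (leq_ltn_trans _ pN) //.
  exact: (leq_bigmax (F := fun i : 'I_(size d) => `|(d`_i)%R|%N) (Ordinal id)).
exists (z *m invmx L); rewrite ME !mulmxA mulmxKV // zE /x' mulmxKV //.
Qed.

(** By the Chinese remainder theorem some [z < m * m'] is a multiple of [m'] congruent to [k] modulo
    [m]; then [k - z] is a multiple of [m]. *)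
Lemma addn_closed_coprime (P : nat -> Prop) m m' k :
  P 0%N -> (forall a b, P a -> P b -> P (a + b)%N) ->
  (0 < m)%N -> (0 < m')%N -> coprime m m' -> P m -> P m' ->
  (m * m' <= k)%N -> P k.
Proof.
move=> P0 PD m0 m'0 co Pm Pm' mk.
have PM a b : P b -> P (a * b)%N.
  by move=> Pb; elim: a => [|a IH] //; rewrite mulSn; apply: PD.
pose z := (chinese m m' k 0 %% (m * m'))%N.
have zk : (z <= k)%N by rewrite (leq_trans _ mk) // ltnW // ltn_mod muln_gt0 m0.
have m'z : (m' %| z)%N.
  by rewrite /dvdn modn_dvdm ?dvdn_mull // chinese_modr // mod0n.
have mkz : (m %| k - z)%N.
  rewrite -eqn_mod_dvd //; apply/eqP.
  by rewrite /z modn_dvdm ?dvdn_mulr // chinese_modl.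
have Pz : P z by rewrite -(divnK m'z); apply: PM.
by rewrite -(subnK zk); apply: PD => //; rewrite -(divnK mkz); apply: PM.
Qed.

(** * Faces of the cone of a semigroup *)

Lemma dotpE (R : realType) n : @dotp R n = @dot R n.
Proof. by []. Qed.

Section Semigroup.
Variables (R : realType) (n : nat) (s : seq 'rV[int]_n).
Let A := monoid_gen [set` s].

Lemma cone_toR a : A a -> cone R A (toR R a).
Proof.
move=> Aa; exists 1%N, (fun=> a), (fun=> 1); split=> //.
by rewrite big_ord1 scale1r.
Qed.

Lemma toR_divn (v : 'rV[int]_n) k :
  (0 < k)%N -> toR R v = k%:R^-1 *: toR R (v *+ k).
Proof.
by move=> k0; rewrite toRMn scalerA mulVf ?scale1r // pnatr_eq0 -lt0n.
Qed.

Lemma cone_divn v k : (0 < k)%N -> A (v *+ k) -> cone R A (toR R v).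
Proof.
move=> k0 Av; exists 1%N, (fun=> v *+ k), (fun=> k%:R^-1); split.
  by rewrite invr_ge0 ler0n.
by rewrite big_ord1 -toR_divn.
Qed.

Lemma linear_span_divn (F : set 'rV[R]_n) (v : 'rV[int]_n) k :
  (0 < k)%N -> F (toR R (v *+ k)) -> linear_span F (toR R v).
Proof.
move=> k0 Fv; exists 1%N, (fun=> toR R (v *+ k)), (fun=> k%:R^-1); split=> //.
by rewrite big_ord1 -toR_divn.
Qed.

Lemma face_cone (u : 'rV[R]_n) : (forall a, A a -> 0 <= dotp u (toR R a)) ->
  face (cone R A) (cone R A `&` [set x | dotp u x = 0]).
Proof.
move=> uA; exists u; split=> // _ [k [a [c [Aac ->]]]].
rewrite dotpE dot_sumr sumr_ge0 // => i _.
by rewrite mulr_ge0 ?uA; case: (Aac i).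
Qed.

(** The supporting functional vanishes at a positive multiple of [v], hence at [v] and at all its
    multiples. *)
Lemma face_divn (F : set 'rV[R]_n) v k l : face (cone R A) F ->
  (0 < k)%N -> F (toR R (v *+ k)) -> A (v *+ l) -> F (toR R (v *+ l)).
Proof.
move=> [u [_ ->]] k0 [_ /=]; rewrite dotpE toRMn dotZr => /eqP.
rewrite mulf_eq0 pnatr_eq0 -[k == 0]leqn0 leqNgt k0 /= => /eqP uv Al.
by split; [apply: cone_toR|rewrite /= toRMn dotZr uv mulr0].
Qed.

Lemma face_monoid (F : set 'rV[R]_n) : face (cone R A) F ->
  let B := A `&` toR R @^-1` F in
  B 0 /\ forall a b, B a -> B b -> B (a + b).
Proof.
move=> [u [_ ->]] /=; split.
  split; first exact: monoid_gen0.
  rewrite /preimage /= toR0; split; last exact: (dot0r u).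
  by exists 0%N, (fun=> 0), (fun=> 0); rewrite big_ord0; split=> [[]|].
move=> a b [Aa [_ /= ua]] [Ab [_ /= ub]].
have Aab : A (a + b) by apply: monoid_genD.
split=> //; split; first exact: cone_toR.
by rewrite /= toRD dotpE dotDr [dot _ _]ua [dot _ _]ub addr0.
Qed.

(** The supporting functional is nonnegative on [A], so a sum in [A] lies on the face only if both
    summands do. A face thus matters only through a sublist of [s], which leaves finitely many
    subgroups. *)
Lemma group_gen_face (F : set 'rV[R]_n) : face (cone R A) F ->
  group_gen (A `&` toR R @^-1` F) =
  group_gen [set` [seq a <- s | `[< F (toR R a) >]]].
Proof.
move=> [u [u0 FE]]; set t := [seq _ <- _ | _].
have uA a : A a -> 0 <= dot u (toR R a) by move=> /cone_toR/u0.
apply/seteqP; split; apply: group_gen_sub; last first.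
  move=> a /=; rewrite mem_filter => /andP[/asboolP Fa sa].
  by apply: sub_group_gen; split=> //; apply: sub_monoid_gen.
suff h : A `<=` [set a | A a /\ (dot u (toR R a) = 0 -> group_gen [set` t] a)].
  by move=> a [/h[_ ta]]; rewrite /preimage /= FE => -[_]; apply: ta.
apply: monoid_gen_ind => [|x y [Ax tx] [Ay ty]|a sa].
- by split; [apply: monoid_gen0|move=> _; apply: group_gen0].
- split; first exact: monoid_genD.
  rewrite toRD dotDr => xy; have := uA _ Ax; have := uA _ Ay => hy hx.
  by apply: group_genD; [apply: tx|apply: ty]; lra.
have Aa : A a by apply: sub_monoid_gen.
split=> // ua; apply: sub_group_gen; rewrite /= mem_filter sa andbT.
by apply/asboolP; rewrite FE; split=> //; apply: cone_toR.
Qed.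

Lemma Ass_face_quotient p (F : set 'rV[R]_n) : prime p ->
  Ass (zmodule (face_quotient A F)) (principal_ideal p%:Z) <->
  exists x, [/\ group_gen A x, linear_span F (toR R x),
    ~ group_gen (A `&` toR R @^-1` F) x &
    group_gen (A `&` toR R @^-1` F) (x *+ p)].
Proof.
move=> p_pr; rewrite Ass_subgroup_quotient //; split=> -[x].
  move=> [/set_mem[Gx Fx] xF /set_mem pxF]; exists x; split=> //.
  by move=> /mem_set; apply/negP.
move=> [Gx Fx xF pxF]; exists x; split; [exact: mem_set| |exact: mem_set].
by apply/negP => /set_mem.
Qed.

(** * Comparison of the two normalizations *)

Lemma seminormalization_sub_weak p : prime p ->
  seminormalization A `<=` weak_normalization R p A.
Proof.
move=> p_pr v [Gv [m [m' [co Am Am']]]].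
have Am0 : A (v *+ 0) by apply: monoid_gen0.
suff [e Ae] : exists e, A (v *+ (p ^ e)).
  split; last by exists e.
  by split=> //; apply: cone_divn Ae; rewrite expn_gt0 prime_gt0.
(* If one of the coprime numbers is 0, the other is 1 and [v] itself is in [A]. *)
have [m0|m0] := posnP m.
  move: co; rewrite m0 /coprime gcd0n => /eqP m'1.
  by exists 0%N; rewrite m'1 in Am'.
have [m'0|m'0] := posnP m'.
  move: co; rewrite m'0 /coprime gcdn0 => /eqP m1.
  by exists 0%N; rewrite m1 in Am.
(* The [k] with [A (v *+ k)] include everything from [m * m'] on, and [p ^ (m * m')] exceeds
   [m * m']. *)
exists (m * m')%N.
apply: (@addn_closed_coprime (fun k => A (v *+ k)) m m') => //.
  by move=> a b Aa Ab; rewrite mulrnDr; apply: monoid_genD.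
by rewrite ltnW // ltn_expl // prime_gt1.
Qed.

Lemma weak_neq_seminormalization p : prime p ->
  weak_normalization R p A <> seminormalization A <->
  exists2 v, weak_normalization R p A v & ~ seminormalization A v.
Proof.
move=> p_pr; split=> [ne|[v wv sv] E]; last by rewrite -E in sv.
apply: contrapT => h; apply: ne; apply/seteqP; split.
  by move=> v wv; apply: contrapT => sv; apply: h; exists v.
exact: seminormalization_sub_weak.
Qed.

Lemma face_torsion_weak p (F : set 'rV[R]_n) x : prime p ->
  face (cone R A) F -> group_gen A x ->
  ~ group_gen (A `&` toR R @^-1` F) x ->
  group_gen (A `&` toR R @^-1` F) (x *+ p) ->
  exists2 v, weak_normalization R p A v & ~ seminormalization A v.
Proof.
move=> p_pr fF Gx xF; have [B0 BD] := face_monoid fF.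
set B := A `&` _ in xF B0 BD *.
move=> /(group_gen_monoid B0 BD)[a [b [Ba Bb xab]]].
(* Here [(x + b) *+ p = a + b *+ (p - 1)]. *)
have Bv : B ((x + b) *+ p).
  rewrite mulrnDl xab; case: (p) (prime_gt0 p_pr) => // k _.
  rewrite mulrS addrA subrK; apply: (BD) => //.
  exact: addr_closedMn.
have Gv : group_gen A (x + b).
  by apply: group_genD => //; apply: sub_group_gen; case: Bb.
exists (x + b).
  split; last by exists 1%N; rewrite expn1; case: Bv.
  by split=> //; apply: (@cone_divn _ p); [apply: prime_gt0|case: Bv].
move=> [_ [m [m' [co Am Am']]]]; apply: xF.
(* A multiple of [x + b] in [A] automatically lies on [F], because the [p]-th one does; Bezout can
   therefore be applied inside [group_gen B]. *)
have Bm l : A ((x + b) *+ l) -> group_gen B ((x + b) *~ l).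
  move=> Al; apply: sub_group_gen; split=> //.
  by apply: (face_divn fF (prime_gt0 p_pr)) => //; case: Bv.
have : group_gen B (x + b).
  apply/set_mem; apply: (zmod_closed_coprime (group_gen_zmod_closed B)
    (a := m) (b := m')) => //; apply/mem_set; exact: Bm.
move=> h; rewrite -[x](addrK b).
by apply: group_genB => //; apply: sub_group_gen.
Qed.

Lemma weak_face_torsion p v : prime p ->
  weak_normalization R p A v -> ~ seminormalization A v ->
  exists (F : set 'rV[R]_n) x, [/\ face (cone R A) F, group_gen A x,
    linear_span F (toR R x), ~ group_gen (A `&` toR R @^-1` F) x &
    group_gen (A `&` toR R @^-1` F) (x *+ p)].
Proof.
move=> p_pr [[Gv _] [e Aw]] nsv.
have [u [uA uw uN]] := minimal_face Aw.
have dotE a : dotp (map_mx ratr u) (toR R a) = ratr (dot u (toQ a)).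
  rewrite dotpE -dot_map; congr dot.
  by apply/rowP => j; rewrite !mxE /= ratr_int.
pose F := cone R A `&` [set x | dotp (map_mx ratr u) x = 0].
have fF : face (cone R A) F.
  by apply: face_cone => a /uA; rewrite dotE ler0q.
have [B0 BD] := face_monoid fF.
pose B := A `&` toR R @^-1` F.
have Bw : B (v *+ p ^ e).
  split=> //; split; first exact: cone_toR.
  by rewrite /= dotE uw raddf0.
have nBv : ~ group_gen B v.
  move=> /(group_gen_monoid B0 BD)[a [b [[Aa _] [Ab [_ /= ub]] vE]]].
  have [|N AN] := uN b Ab.
    by move: ub; rewrite dotE => /eqP; rewrite fmorph_eq0 => /eqP.
  (* With [w = v *+ p ^ e], the multiple by [p ^ e * N + 1] is [v + w *+ N = a + (w *+ N - b)]. *)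
  apply: nsv; split=> //; exists (p ^ e * N).+1, (p ^ e)%N; split=> //.
    by rewrite coprime_sym /coprime mulnC -addn1 gcdnMDl gcdn1.
  rewrite mulrS mulrnA {1}vE addrAC -addrA; apply: monoid_genD => //.
(* Among the multiples [v *+ p ^ j], take the last one outside [group_gen B]. *)
have [j [nBj Bj]] : exists j,
    ~ group_gen B (v *+ p ^ j) /\ group_gen B (v *+ p ^ j.+1).
  apply: contrapT => h.
  suff nB i : ~ group_gen B (v *+ p ^ i) by apply: (nB e); apply: sub_group_gen.
  elim: i => [|i IH Bi]; first by rewrite expn0 mulr1n; exact: nBv.
  by apply: h; exists i.
exists F, (v *+ p ^ j); split=> //.
- by rewrite pmulrn; apply: group_genMz.
(* Multiplying [v *+ p ^ j] by [p ^ e] gives a multiple of the point [v *+ p ^ e] of [B]. *)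
- apply: (@linear_span_divn _ _ (p ^ e)); first by rewrite expn_gt0 prime_gt0.
  rewrite -mulrnA mulnC mulrnA.
  by case: (addr_closedMn (p ^ j) B0 BD Bw).
by rewrite -mulrnA -expnSr.
Qed.

End Semigroup.

(** * The equivalence and the finiteness of the set of primes *)

Unset Implicit Arguments.

Theorem proposition4p2 (R : realType) (n : nat) (A : set 'rV[int]_n)
    (hA : affine_semigroup A) :
  (forall p : nat, prime p ->
     ((exists F : set 'rV[R]_n,
         face (cone R A) F /\
         Ass (zmodule (face_quotient A F)) (principal_ideal p%:Z))
      <-> weak_normalization R p A <> seminormalization A)) /\
  finite_set [set p : nat | prime p /\
                weak_normalization R p A <> seminormalization A].
Proof.
case: hA => _ [s ->]; split=> [p p_pr|].
  rewrite weak_neq_seminormalization //; split.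
    move=> [F [fF /(Ass_face_quotient _ _ p_pr)[x [Gx _ xF pxF]]]].
    exact: (face_torsion_weak p_pr fF Gx).
  move=> [v wv sv].
  have [F [x [fF Gx Fx xF pxF]]] := weak_face_torsion p_pr wv sv.
  by exists F; split=> //; apply/Ass_face_quotient => //; exists x.
(* One torsion bound per sublist of [s], coded by a bit mask; masks form a finite type, so the
   maximum of the bounds serves every face. *)
have /choice[N hN] := fun m : (size s).-tuple bool =>
  group_gen_torsion_bound (mask m s).
apply: (sub_finite_set (B := `I_(\max_m N m).+1)); last exact: finite_II.
move=> p /= [p_pr /(weak_neq_seminormalization R s p_pr)[v wv sv]].
have [F [x [fF _ _ xF pxF]]] := weak_face_torsion p_pr wv sv.
move: xF pxF; rewrite group_gen_face // filter_mask => xF pxF.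
rewrite ltnS; apply: leq_trans (leq_bigmax _).
exact: (hN (map_tuple (fun a => `[< F (toR R a) >]) (in_tuple s)) p x).
Qed.
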